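(* There exist $t_0>0$ and $c>0$ such that for all $d\in\mathbb{N}$ and $G\in\mathcal{F}_d$ the following holds. (i) If $\widetilde{\kappa}(G)\ge 1/2$ and $t\ge t_0$, then $$\Big|\Big\{x\in G\cap\mathbb{Z}^d:\frac{|x|_2}{\sqrt d}\ge t\,\widetilde{\kappa}(G)\Big\}\Big|\le e^{-ct\sqrt d}\,|G\cap\mathbb{Z}^d|.$$ (ii) If $\widetilde{\kappa}(G)\in(0,1/2]$ and $t\ge t_0$, then $$\Big|\Big\{x\in G\cap\mathbb{Z}^d:\frac{|x|_2}{\sqrt d}\ge t\sqrt{\widetilde{\kappa}(G)}\Big\}\Big|\le \widetilde{\kappa}(G)^{\,ct\sqrt{d\,\widetilde{\kappa}(G)}}\,|G\cap\mathbb{Z}^d|.$$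
   Context: A convex body in $\mathbb{R}^d$ is a closed, bounded, convex set with non-empty interior. It is 1-symmetric if it is invariant under all coordinate permutations and under all coordinate sign changes $x\mapsto(\epsilon_1x_1,\dots,\epsilon_dx_d)$, $\epsilon\in\{-1,1\}^d$. $\mathcal{F}_d$ is the family of all 1-symmetric convex bodies in $\mathbb{R}^d$. $|x|_1=\sum_{i=1}^d|x_i|$ and $|x|_2=(\sum_{i=1}^dx_i^2)^{1/2}$. For $G\in\mathcal{F}_d$, $\widetilde{\kappa}(G)=\max_{x\in G\cap\mathbb{Z}^d}|x|_1/d$. For a finite set $A$, $|A|$ is its cardinality. *)

(* Defs.v *)
From HB Require Import structures.
From mathcomp Require Import all_boot all_order all_algebra.
From mathcomp Require Import finmap perm.
From mathcomp Require Import all_classical all_reals all_analysis.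

Set Implicit Arguments.
Unset Strict Implicit.
Unset Printing Implicit Defensive.

Import Order.TTheory GRing.Theory Num.Theory.
Import numFieldNormedType.Exports.

Local Open Scope classical_set_scope.
Local Open Scope ring_scope.

Definition convex_body (R : realType) (d : nat) (G : set 'rV[R]_d) : Prop :=
  [/\ closed G, bounded_set G, convex_set G & interior G !=set0].

Definition sign_change (R : realType) (d : nat) (eps : {ffun 'I_d -> bool})
    (x : 'rV[R]_d) : 'rV[R]_d :=
  \row_i ((-1) ^+ eps i * x 0 i).

Definition one_symmetric (R : realType) (d : nat) (G : set 'rV[R]_d) : Prop :=
  (forall s : 'S_d, [set col_perm s x | x in G] = G) /\
  (forall eps : {ffun 'I_d -> bool}, [set sign_change eps x | x in G] = G).

Definition one_symmetric_bodies (R : realType) (d : nat) :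
    set (set 'rV[R]_d) :=
  [set G | convex_body G /\ one_symmetric G].

Arguments one_symmetric_bodies R d _ : clear implicits.

Definition l1norm (R : realType) (d : nat) (x : 'rV[R]_d) : R :=
  \sum_(i < d) `|x 0 i|.

Definition l2norm (R : realType) (d : nat) (x : 'rV[R]_d) : R :=
  Num.sqrt (\sum_(i < d) x 0 i ^+ 2).

Definition integer_lattice (R : realType) (d : nat) : set 'rV[R]_d :=
  [set x | forall i, x 0 i \is a Num.int].

Arguments integer_lattice R d _ : clear implicits.

(* [fset_set] is the empty set on infinite arguments; below it is only applied
   to subsets of G `&` integer_lattice R d with G bounded, which are finite. *)
Definition set_card (R : realType) (d : nat) (A : set 'rV[R]_d) : nat :=
  #|` fset_set A|.

(* For G in [one_symmetric_bodies], the lattice points of G form a finite set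
   containing 0 and the terms are nonnegative, so the default value 0 does not
   affect the maximum. *)
Definition kappa (R : realType) (d : nat) (G : set 'rV[R]_d) : R :=
  \big[Num.max/0]_(x <- fset_set (G `&` integer_lattice R d))
    (l1norm x / d%:R).

(* Main.v *)
(* Write K = kappa G and S for the lattice points of G; S is closed under weak
   majorization of absolute values.  If |x|_2 is large then for some k the k
   largest coordinates of x exceed a threshold growing like
   sqrt N / k + (N / k)^(1/4), with N = d or N = K d, so it suffices to bound,
   for each set I of size k, the set A of those x in S with |x_i| >= a on I;
   the second term of the threshold pays for the choice of I.

   Lowering the coordinates in I by about a / 2 frees a mass that may be given
   to small coordinates without leaving S.  If K >= 1/2, each small coordinate
   independently receives h ~ K more, with a probability tuned so that the
   expected total is below the freed mass, which is about m h; every point of S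
   then receives total weight at most exp (- m / 6), whence
   |A| <= 2 exp (- m / 6) |S|.  If K <= 1/2, most coordinates vanish, and one
   writes signs +1, -1 on m of the zeros; as a point of S has at most K d nonzero
   coordinates, comparing C(d - K d, m) 2^m images with C(K d, m) preimages
   gives |A| <= K^m |S|. *)
Require Import Defs.
From HB Require Import structures.
From mathcomp Require Import all_boot all_order all_algebra.
From mathcomp Require Import finmap perm.
From mathcomp Require Import all_classical all_reals all_analysis.
From mathcomp Require Import ring lra zify.

Set Implicit Arguments.
Unset Strict Implicit.
Unset Printing Implicit Defensive.

Import Order.TTheory GRing.Theory Num.Theory.
Import numFieldNormedType.Exports.

Local Open Scope classical_set_scope.
Local Open Scope ring_scope.

(** * Weak majorization in a 1-symmetric convex set *)

Section Bodies.
Variables (R : realType) (d : nat) (G : set 'rV[R]_d).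
Hypotheses (Gconv : convex_set G) (Gsym : one_symmetric G).

Lemma body_conv (x y : 'rV[R]_d) (l : R) :
  0 <= l -> l <= 1 -> G x -> G y -> G (l *: x + (1 - l) *: y).
Proof.
move=> l0 l1 Gx Gy.
have := Gconv (Itv01 l0 l1) (mem_set Gx) (mem_set Gy).
by rewrite inE.
Qed.

Lemma body_sign eps (x : 'rV[R]_d) : G x -> G (sign_change eps x).
Proof. by move=> Gx; rewrite -(Gsym.2 eps); exists x. Qed.

Lemma body_perm (s : 'S_d) (x : 'rV[R]_d) : G x -> G (col_perm s x).
Proof. by move=> Gx; rewrite -(Gsym.1 s); exists x. Qed.

Definition abs_row (x : 'rV[R]_d) : 'rV[R]_d := \row_i `|x 0 i|.

Lemma body_abs (x : 'rV[R]_d) : G (abs_row x) <-> G x.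
Proof.
pose e : {ffun 'I_d -> bool} := [ffun i => x 0 i < 0].
have sgE i : (-1) ^+ (e i) * x 0 i = `|x 0 i|.
  by rewrite ffunE; case: ltrP => h; rewrite ?expr1 ?expr0; 
    [rewrite ltr0_norm // mulN1r | rewrite ger0_norm // mul1r].
split=> [/(body_sign e)|/(body_sign e)]; congr G; apply/rowP=> i; rewrite !mxE.
  by rewrite -sgE mulrA -expr2 sqrr_sign mul1r.
by rewrite sgE.
Qed.

(** Induction on the number of coordinates where [z] and [y] differ: each step moves [z] inside [G]
    so that one more coordinate agrees with [y]. Mass goes from a coordinate that is too large to
    one that is too small, and the condition [y 0 j <= y 0 i] keeps every such transfer an
    averaging. *)
Lemma body_weak_majorization_nonneg n (z y : 'rV[R]_d) :
  (#|[pred i | (z 0 i != y 0 i)%R]| <= n)%N ->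
  (forall i, 0 <= z 0 i) -> (forall i, 0 <= y 0 i) ->
  (forall i j, y 0 i < z 0 i -> z 0 j < y 0 j -> y 0 j <= y 0 i) ->
  \sum_i y 0 i <= \sum_i z 0 i -> G z -> G y.
Proof.
elim: n z => [|n IH] z hn z0 y0 yz hs Gz.
  suff -> : y = z by [].
  apply/rowP=> i; apply/esym/eqP; apply: contraT => zyi.
  by move: hn; rewrite leqn0 => /eqP/card0_eq/(_ i); rewrite !inE zyi.
have [/existsP[j zj]|] := boolP [exists j, z 0 j < y 0 j]; last first.
  rewrite negb_exists => /forallP nj.
  have [/existsP[i zi]|] := boolP [exists i, y 0 i < z 0 i]; last first.
    rewrite negb_exists => /forallP ni.
    suff -> : y = z by [].
    by apply/rowP=> i; apply/eqP; rewrite eq_le !leNgt ni nj.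
  (* With nothing left to raise, coordinate [i] is shrunk by averaging [z] with its reflection in
     that coordinate. *)
  pose z' : 'rV[R]_d := \row_k if k == i then y 0 i else z 0 k.
  have zi0 : 0 < z 0 i by apply: le_lt_trans zi.
  apply: (IH z').
  - rewrite -ltnS; apply: leq_trans hn; apply: proper_card; apply/properP.
    split.
      apply/fintype.subsetP=> k; rewrite !inE mxE.
      by have [->|] := eqVneq k i; rewrite ?eqxx.
    by exists i; rewrite !inE ?mxE ?eqxx // gt_eqF.
  - by move=> k; rewrite mxE; case: eqP.
  - by [].
  - by move=> k j _; rewrite mxE; case: eqP => [->|_]; rewrite ?ltxx // (negbTE (nj j)).
  - apply: ler_sum => k _; rewrite mxE; case: eqP => [->//|_].
    by rewrite leNgt nj.
  - pose e : {ffun 'I_d -> bool} := [ffun k => k == i].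
    have l0 : 0 <= (1 + y 0 i / z 0 i) / 2.
      by rewrite divr_ge0 // addr_ge0 // divr_ge0.
    have l1 : (1 + y 0 i / z 0 i) / 2 <= 1.
      have : y 0 i / z 0 i <= 1 by rewrite ler_pdivrMr // mul1r ltW.
      lra.
    have := body_conv l0 l1 Gz (body_sign e Gz).
    congr G; apply/rowP => k; rewrite !mxE ffunE; case: eqP => [->|_] /=.
      by rewrite expr1; field; rewrite gt_eqF.
    by rewrite expr0; ring.
have [/existsP[i zi]|] := boolP [exists i, y 0 i < z 0 i]; last first.
  rewrite negb_exists => /forallP ni.
  have : \sum_i z 0 i < \sum_i y 0 i.
    rewrite (bigD1 j) //= [ltRHS](bigD1 j) //=; apply: ltr_leD => //.
    by apply: ler_sum => k _; rewrite leNgt ni.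
  by rewrite ltNge hs.
have yji := yz _ _ zi zj.
have nij : i != j by apply: contraTneq zi => ->; rewrite -leNgt ltW.
have zji : 0 < z 0 i - z 0 j by lra.
(* The largest transfer from [i] to [j] that overshoots neither target, so that one of the two
   coordinates becomes final. *)
pose r := Num.min (z 0 i - y 0 i) (y 0 j - z 0 j).
have r1 : r <= z 0 i - y 0 i by rewrite /r ge_min lexx.
have r2 : r <= y 0 j - z 0 j by rewrite /r ge_min lexx orbT.
have r0 : 0 < r by rewrite /r lt_min !subr_gt0 zi zj.
have rE : r = z 0 i - y 0 i \/ r = y 0 j - z 0 j.
  by rewrite /r; case: ltP; [left|right].
pose z' : 'rV[R]_d :=
  \row_k if k == i then z 0 i - r else if k == j then z 0 j + r else z 0 k.
have z'i : z' 0 i = z 0 i - r by rewrite mxE eqxx.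
have z'j : z' 0 j = z 0 j + r by rewrite mxE eq_sym (negbTE nij) eqxx.
have z'k k : k != i -> k != j -> z' 0 k = z 0 k.
  by move=> ki kj; rewrite mxE (negbTE ki) (negbTE kj).
apply: (IH z').
- rewrite -ltnS; apply: leq_trans hn; apply: proper_card; apply/properP.
  split.
    apply/fintype.subsetP=> k; rewrite !inE.
    have [->|ki] := eqVneq k i; first by rewrite (gt_eqF zi).
    have [->|kj] := eqVneq k j; first by rewrite (lt_eqF zj).
    by rewrite z'k.
  case: rE => rE.
    by exists i; rewrite !inE ?(gt_eqF zi) // z'i rE opprB addrC subrK eqxx.
  by exists j; rewrite !inE ?(lt_eqF zj) // z'j rE addrC subrK eqxx.
- move=> k; have [->|ki] := eqVneq k i; first by rewrite z'i; have := y0 i; lra.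
  have [->|kj] := eqVneq k j; first by rewrite z'j; have := z0 j; lra.
  by rewrite z'k.
- by [].
- move=> k l hk hl; apply: yz.
    have [kE|ki] := eqVneq k i; first by rewrite kE.
    have [kE|kj] := eqVneq k j; first by move: hk; rewrite kE z'j; lra.
    by rewrite -(z'k k).
  have [lE|li] := eqVneq l i; first by move: hl; rewrite lE z'i; lra.
  have [lE|lj] := eqVneq l j; first by rewrite lE.
  by rewrite -(z'k l).
- apply: (le_trans hs); rewrite (bigD1 i) //= (bigD1 j) 1?eq_sym //=.
  rewrite [leRHS](bigD1 i) //= [X in _ <= _ + X](bigD1 j) 1?eq_sym //= z'i z'j.
  rewrite (eq_bigr (z' 0)); first by lra.
  by move=> k /andP[ki kj]; rewrite z'k.
(* The transfer is a convex combination of [z] and [z] with coordinates [i] and [j] exchanged; the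
   weight is legitimate as [z 0 j < y 0 j <= y 0 i < z 0 i]. *)
- have l0 : 0 <= 1 - r / (z 0 i - z 0 j).
    by rewrite subr_ge0 ler_pdivrMr // mul1r; lra.
  have l1 : 1 - r / (z 0 i - z 0 j) <= 1.
    by rewrite gerBl divr_ge0 // ltW.
  have := body_conv l0 l1 Gz (body_perm (tperm i j) Gz).
  congr G; apply/rowP => k.
  transitivity ((1 - r / (z 0 i - z 0 j)) * z 0 k
      + (1 - (1 - r / (z 0 i - z 0 j))) * z 0 (tperm i j k)).
    by rewrite !mxE.
  have [->|ki] := eqVneq k i.
    by rewrite z'i tpermL; field; rewrite gt_eqF.
  have [->|kj] := eqVneq k j.
    by rewrite z'j tpermR; field; rewrite gt_eqF.
  by rewrite z'k // tpermD 1?eq_sym //; ring.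
Qed.

(** Instead of comparing partial sums of sorted coordinates, the hypothesis asks that raised
    coordinates end no higher than lowered ones, a property that can be read off directly from the
    maps used below. *)
Lemma body_weak_majorization (x y : 'rV[R]_d) :
  (forall i j, `|y 0 i| < `|x 0 i| -> `|x 0 j| < `|y 0 j| ->
    `|y 0 j| <= `|y 0 i|) ->
  l1norm y <= l1norm x -> G x -> G y.
Proof.
move=> xy hs /body_abs Gx; apply/body_abs.
apply: (body_weak_majorization_nonneg (leqnn _) _ _ _ _ Gx).
- by move=> i; rewrite mxE.
- by move=> i; rewrite mxE.
- by move=> i j; rewrite !mxE; exact: xy.
- have E v : \sum_i abs_row v 0 i = l1norm v by apply: eq_bigr => i _; rewrite mxE.
  by rewrite !E.
Qed.

End Bodies.

(** * Weighted double counting *)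

Lemma ler_sum_subseq_uniq (R : numDomainType) (T : eqType) (s1 s2 : seq T) (F : T -> R) :
  uniq s1 -> uniq s2 -> {subset s1 <= s2} -> (forall x, x \in s2 -> 0 <= F x) ->
  \sum_(x <- s1) F x <= \sum_(x <- s2) F x.
Proof.
move=> u1 u2 s12 F0.
have s1E : perm_eq s1 [seq x <- s2 | x \in s1].
  apply: uniq_perm => //; first exact: filter_uniq.
  by move=> x; rewrite mem_filter; case: (boolP (x \in s1)) => //= /s12.
rewrite (perm_big _ s1E) big_filter [leRHS](bigID (mem s1)) /= lerDl big_seq_cond.
by apply: sumr_ge0 => x /andP[/F0].
Qed.

(** For a fixed [p] the map [phi p] is injective on its domain and does not decrease weights, so its
    share of the left side is a partial sum of the right one; then the two sums are exchanged. The
    parameter [p] will be a set of coordinates to raise, possibly with a choice of signs. *)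
Lemma double_count (R : numDomainType) (T U : choiceType) (P : finType)
    (A : {fset T}) (S : {fset U}) (D : T -> P -> bool) (phi : P -> T -> U)
    (w : T -> P -> R) (w' : U -> P -> R) :
  (forall p y, y \in S -> 0 <= w' y p) ->
  (forall p x x', x \in A -> x' \in A -> D x p -> D x' p ->
     phi p x = phi p x' -> x = x') ->
  (forall x p, x \in A -> D x p -> phi p x \in S /\ w x p <= w' (phi p x) p) ->
  \sum_(x <- A) \sum_(p | D x p) w x p <= \sum_(y <- S) \sum_p w' y p.
Proof.
move=> w'0 inj wD.
rewrite (exchange_big_dep predT) //= [leRHS]exchange_big /=.
apply: ler_sum => p _.
pose s := [seq x <- A | D x p].
apply: (@le_trans _ _ (\sum_(y <- [seq phi p x | x <- s]) w' y p)).
  rewrite big_map big_filter big_seq_cond [leRHS]big_seq_cond.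
  by apply: ler_sum => x /andP[/wD h /h[]].
apply: ler_sum_subseq_uniq => //.
- rewrite map_inj_in_uniq ?filter_uniq ?fset_uniq // => x x'.
  rewrite !mem_filter => /andP[Dx xA] /andP[Dx' x'A]; exact: inj.
- move=> y /mapP[x]; rewrite mem_filter => /andP[Dx xA] ->.
  by have [] := wD _ _ xA Dx.
- by move=> y; apply: w'0.
Qed.

(** * Moving coordinates away from or towards zero *)

Section Push.
Variable R : archiRealDomainType.

Definition push (r x : R) : R := if 0 <= x then x + r else x - r.

Lemma normr_push r x : 0 <= `|x| + r -> `|push r x| = `|x| + r.
Proof.
rewrite /push; case: (lerP 0 x) => x0.
  by rewrite (ger0_norm x0) => h; rewrite ger0_norm.
by rewrite (ltr0_norm x0) => h; rewrite ler0_norm; lra.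
Qed.

(** Strict positivity keeps the image nonzero and of the same sign as the argument, with 0 counted
    as nonnegative, so the sign can be read off the image. *)
Lemma push_inj r x x' : 0 < `|x| + r -> 0 < `|x'| + r ->
  push r x = push r x' -> x = x'.
Proof.
rewrite /push; case: (lerP 0 x) => x0; case: (lerP 0 x') => x'0;
  rewrite ?(ger0_norm x0) ?(ger0_norm x'0) ?(ltr0_norm x0) ?(ltr0_norm x'0);
  lra.
Qed.

Lemma push_int r x :
  r \is a Num.int -> x \is a Num.int -> push r x \is a Num.int.
Proof. by move=> ? ?; rewrite /push; case: (0 <= x); [rewrite rpredD|rewrite rpredB]. Qed.

End Push.

Section PushRow.
Variables (R : archiRealDomainType) (d : nat).
Implicit Types (r : 'I_d -> R) (E : {set 'I_d}) (x : 'rV[R]_d).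

(** The sign flips on [E] encode the choice of signs in the sparse case; the dense case takes [E]
    empty. *)
Definition push_row r E x : 'rV[R]_d :=
  \row_i ((-1) ^+ (i \in E) * push (r i) (x 0 i)).

Lemma normr_push_row r E x i : 0 <= `|x 0 i| + r i ->
  `|push_row r E x 0 i| = `|x 0 i| + r i.
Proof.
by move=> h; rewrite mxE normrM normr_sign mul1r normr_push.
Qed.

Lemma push_row_inj r E x x' i : 0 < `|x 0 i| + r i -> 0 < `|x' 0 i| + r i ->
  push_row r E x = push_row r E x' -> x 0 i = x' 0 i.
Proof.
move=> h h' /rowP/(_ i); rewrite !mxE => /(mulfI _) e.
by apply: (push_inj h h'); apply: e; rewrite signr_eq0.
Qed.

End PushRow.

(** * Lattice points of a body and the quantity [kappa] *)

Section LatticePoints.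
Variables (R : realType) (d : nat) (G : set 'rV[R]_d).
Hypothesis HG : one_symmetric_bodies R d G.

Definition lattice_points := fset_set (G `&` integer_lattice R d).

Lemma finite_bounded_lattice : finite_set (G `&` integer_lattice R d).
Proof.
case: HG => -[_ bG _ _] _.
have [M hM] : exists M : R, forall x, G x -> `|x| <= M.
  by have /pinfty_ex_gt0[M _ ] := bG; exists M.
pose n := (Num.truncn `|M|).+1.
(* Coordinates are integers between [- n] and [n]; adding [n] codes each of them by an ordinal. *)
pose f (a : {ffun 'I_d -> 'I_(n + n).+1}) : 'rV[R]_d :=
  \row_i ((a i)%:R - n%:R).
apply: (@sub_finite_set _ _ (f @` setT)); last exact/finite_image/finite_finset.
move=> x [/hM xM xZ].
have xn i : `|x 0 i| <= n%:R.
  apply: (@le_trans _ _ `|x|).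
    by rewrite /Num.Def.normr /= mx_normrE; apply: (le_bigmax _ _ (0, i)).
  by apply: (le_trans xM); apply: (le_trans (ler_norm _)); rewrite ltW // truncnS_gt.
have xE i : exists a : 'I_(n + n).+1, x 0 i = a%:R - n%:R.
  have /intrP[z zE] := xZ i.
  have := xn i; rewrite zE -intr_norm pmulrn ler_int => zn.
  have lt : (absz (z + n%:Z)%R < (n + n).+1)%N by lia.
  exists (Ordinal lt) => /=.
  have -> : z = (absz (z + n%:Z))%:Z - n%:Z by lia.
  rewrite rmorphB /= -!pmulrn; congr (_%:R - _); lia.
exists [ffun i => sval (cid (xE i))] => //.
by apply/rowP => i; rewrite mxE ffunE; case: cid.
Qed.

Lemma mem_lattice_points x :
  (x \in lattice_points) = (x \in G `&` integer_lattice R d).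
Proof. by rewrite in_fset_set //; exact: finite_bounded_lattice. Qed.

Lemma set_card_lattice (P : pred 'rV[R]_d) :
  set_card [set x | (G `&` integer_lattice R d) x /\ P x] =
  #|` [fset x in lattice_points | P x]%fset|.
Proof.
congr #|` _|; apply/fsetP => x.
rewrite in_fset_set; last first.
  by apply: sub_finite_set finite_bounded_lattice => y [].
rewrite !inE /= mem_lattice_points; apply/idP/andP; rewrite ?inE => -[] //.
Qed.

Lemma l1norm_le_kappa x : (0 < d)%N -> x \in lattice_points ->
  l1norm x <= kappa G * d%:R.
Proof.
move=> d0 xS; rewrite -ler_pdivrMr ?ltr0n //.
rewrite /kappa; exact: (le_bigmax_seq 0 x xpredT _ xS isT).
Qed.

(** Positivity excludes the default value 0, so the maximum is attained at a lattice point, whose l1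
    norm is a natural number. *)
Lemma kappa_lattice : (0 < d)%N -> 0 < kappa G ->
  exists n : nat, kappa G * d%:R = n%:R.
Proof.
move=> d0 k0.
have [x [xS kE]] : exists x, x \in lattice_points /\ kappa G = l1norm x / d%:R.
  move: k0; rewrite /kappa -/lattice_points big_seq.
  elim/big_ind : _ => [|a b ha hb|x xS _]; first by rewrite ltxx.
    by rewrite /Num.max; case: ifP.
  by exists x.
rewrite kE divfK ?pnatr_eq0 -?lt0n //.
apply/natrP; apply: rpred_sum => i _; apply: natr_norm_int.
by move: xS; rewrite mem_lattice_points inE => -[_]; apply.
Qed.

End LatticePoints.

(** * Random subsets with independent memberships *)

Lemma prodrD_subsets (R : comRingType) (T : finType) (F H : T -> R) :
  \prod_i (F i + H i) =
  \sum_(J : {set T}) \prod_i (if i \in J then F i else H i).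
Proof. by rewrite bigA_distr; apply: eq_bigl. Qed.

Lemma expR_half_le2 (R : realType) : expR (2^-1 : R) <= 2.
Proof.
have := expR_ge1Dx (- 2^-1 : R); rewrite expRN => h.
rewrite -[leLHS]invrK -[leRHS]invrK lef_pV2 ?posrE ?invr_gt0 ?expR_gt0 ?ltr0n //.
by apply: le_trans h; lra.
Qed.

(* [J] is distributed as the set of successes of independent Bernoulli trials;
   the bound is Markov's inequality for [2 ^ #|J|]. *)
Lemma bernoulli_card_le (R : realType) (T : finType) (p : T -> R) (m : nat) :
  (forall i, 0 <= p i) -> (forall i, p i <= 1) -> \sum_i p i <= m%:R / 2 ->
  2^-1 <= \sum_(J : {set T} | (#|J| <= m)%N)
            \prod_i (if i \in J then p i else 1 - p i).
Proof.
move=> p0 p1 ps.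
pose w (J : {set T}) := \prod_i (if i \in J then p i else 1 - p i).
have w0 J : 0 <= w J.
  by apply: prodr_ge0 => i _; case: ifP => _ //; rewrite subr_ge0.
have tot : \sum_J w J = 1.
  by rewrite -prodrD_subsets big1 // => i _; rewrite addrC subrK.
have tail : \sum_(J : {set T} | ~~ (#|J| <= m)%N) w J <= 2^-1.
  (* The expectation factors as the product of the [1 + p i], at most [expR (m / 2)], and
     [expR (1 / 2) <= 2]. *)
  have mom : \sum_(J : {set T}) w J * 2 ^+ #|J| <= 2 ^+ m.
    rewrite (eq_bigr (fun J : {set T} =>
      \prod_i (if i \in J then 2 * p i else 1 - p i))); last first.
      move=> J _; rewrite -prodr_const [X in _ * X]big_mkcond -big_split /=.
      by apply: eq_bigr => i _; case: ifP => _; rewrite ?mulr1 // mulrC.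
    rewrite -prodrD_subsets; apply: (@le_trans _ _ (\prod_i expR (p i))).
      apply: ler_prod => i _; have := p0 i; have := expR_ge1Dx (p i).
      by move=> a b; apply/andP; split; lra.
    rewrite -expR_sum; apply: (@le_trans _ _ (expR (m%:R * 2^-1))).
      by rewrite ler_expR.
    by rewrite expRM_natl lerXn2r ?nnegrE ?expR_ge0 // expR_half_le2.
  have : 2 ^+ m.+1 * \sum_(J : {set T} | ~~ (#|J| <= m)%N) w J <= 2 ^+ m.
    apply: le_trans mom; rewrite mulr_sumr big_mkcond /=.
    apply: ler_sum => J _; case: ifP => hJ; last by rewrite mulr_ge0 // exprn_ge0.
    rewrite mulrC ler_wpM2l // ler_weXn2l ?ler1n //.
    by rewrite ltnNge.
  rewrite exprS [2 * _]mulrC -mulrA -ler_pdivlMl ?exprn_gt0 // mulVf ?expf_neq0 //.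
  by lra.
by move: tot; rewrite (bigID (fun J : {set T} => (#|J| <= m)%N)) /=; lra.
Qed.

(** * Points with prescribed large coordinates: the dense case *)

Section LargeCoordinates.
Variables (R : realType) (d : nat) (G : set 'rV[R]_d).
Hypothesis HG : one_symmetric_bodies R d G.
Implicit Types I J : {set 'I_d}.

Definition shift I J (s h : nat) (i : 'I_d) : R :=
  if i \in I then - s%:R else if i \in J then h%:R else 0.

(** The level [b] separates the two kinds of coordinates after the move: lowered ones stay above it,
    raised ones below it. With the bound on the total mass this is what [body_weak_majorization]
    asks. *)
Lemma push_row_lattice x I J E (s h b : nat) :
  x \in lattice_points G ->
  (forall i, i \in I -> (b + s)%:R <= `|x 0 i|) ->
  (forall j, j \in J -> `|x 0 j| + h%:R <= b%:R) ->
  (#|J| * h <= #|I| * s)%N ->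
  push_row (shift I J s h) E x \in lattice_points G.
Proof.
case: HG => -[_ _ Gc _] Gs.
rewrite !(mem_lattice_points HG) !inE => -[Gx xZ] xI xJ cJI.
have xI' i : i \in I -> (0 <= b%:R :> R) && (b%:R <= `|x 0 i| - s%:R).
  by move=> /xI; rewrite natrD ler0n /= lerBrDr.
have nE i : `|push_row (shift I J s h) E x 0 i| = `|x 0 i| + shift I J s h i.
  apply: normr_push_row; rewrite /shift.
  case: ifP => iI; first by have /andP[] := xI' i iI; exact: le_trans.
  by case: ifP => _; rewrite addr_ge0.
split; last first.
  move=> i; rewrite mxE rpredM ?rpredX ?rpredN ?rpred1 // push_int //.
  by rewrite /shift; case: ifP => _; [|case: ifP => _]; rewrite ?rpredN ?rpred_nat ?rpred0.
apply: (body_weak_majorization Gc Gs _ _ Gx).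
  move=> i j; rewrite !nE gtrDl ltrDl {1 2}/shift.
  case: ifP => iI; last by case: ifP => _; rewrite ?ltrn0 ?ltxx.
  case: ifP => jI; first by rewrite oppr_gt0 ltrn0.
  case: ifP => jJ; last by rewrite ltxx.
  move=> _ _; rewrite /shift iI jI jJ; apply: (le_trans (xJ j jJ)).
  by have /andP[] := xI' i iI.
rewrite /l1norm (eq_bigr _ (fun i _ => nE i)) big_split /= gerDl.
(* Only an inequality: where [I] and [J] overlap, [shift] is [- s], which is at most [h - s]. *)
apply: (@le_trans _ _ (\sum_i ((if i \in J then h%:R else 0) - (if i \in I then s%:R else 0)))).
  apply: ler_sum => i _; rewrite /shift; case: ifP => _; case: ifP => _;
    rewrite ?subr0 ?add0r ?lerDr //.
rewrite sumrB -!big_mkcond /= !sumr_const subr_le0 -!mulrnA ler_nat.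
by rewrite mulnC [(s * _)%N]mulnC.
Qed.

(* The values are those of [(1 + z) (4 - z) / 4] at the integers [0, .., 4]: with
   them the total weight received by a point in [card_large_coords_exp] is
   controlled by an affine function of [z], see [bump_profile_step]. *)
Definition bump_profile (z : R) : R :=
  if z < 1 then 1 else if z < 3 then 3 / 2 else if z < 4 then 1 else 0.

Lemma bump_profile_ge0 z : 0 <= bump_profile z.
Proof. by rewrite /bump_profile; do 3?case: ifP => _; lra. Qed.

Lemma bump_profile_le z : bump_profile z <= 3 / 2.
Proof. by rewrite /bump_profile; do 3?case: ifP => _; lra. Qed.

Lemma bump_profile_eq0 z : 4 <= z -> bump_profile z = 0.
Proof.
by move=> z4; rewrite /bump_profile; do 3?case: ltP => ? //; by lra.
Qed.

(** Equality holds at the integers from 0 to 4. The left side depends only on the integer part of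
    [z] and vanishes from 5 on, while the right side increases. *)
Lemma bump_profile_step z : 0 <= z ->
  (if 1 <= z then bump_profile (z - 1) else 0) - bump_profile z <= z / 2 - 1.
Proof.
by move=> z0; rewrite /bump_profile; case: (lerP 1 z) => ?;
  repeat (case: ltP => ?); by lra.
Qed.

Definition large_coords I (a : R) : {fset 'rV[R]_d} :=
  [fset x in lattice_points G | [forall i in I, a <= `|x 0 i|]]%fset.

Lemma large_coordsP I a x : reflect
  (x \in lattice_points G /\ forall i, i \in I -> a <= `|x 0 i|)
  (x \in large_coords I a).
Proof.
rewrite !inE /=; apply: (iffP andP) => -[xS xI]; split => //.
  by move=> i iI; have /forall_inP := xI; apply.
exact/forall_inP.
Qed.

(** Coordinates in [I] start above [5 * h + s] and stay above [5 * h], where the profile is 0: they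
    are never chosen for raising and contribute a factor 1 both before and after the move.
    Coordinates chosen for raising start below [4 * h] and end below [5 * h]. *)
Lemma card_large_coords_exp I (h s m : nat) (K : R) :
  (0 < d)%N -> (0 < h)%N -> K <= h%:R -> (m * h <= #|I| * s)%N ->
  (forall x : 'rV[R]_d, x \in lattice_points G -> l1norm x <= K * d%:R) ->
  #|` large_coords I (5 * h + s)%:R|%:R
  <= 2 * expR (- (m%:R / 6)) * #|` lattice_points G|%:R :> R.
Proof.
move=> d0 h0 Kh mh SK; set A := large_coords _ _; set S := lattice_points G.
have hR : 0 < h%:R :> R by rewrite ltr0n.
have dR : 0 < d%:R :> R by rewrite ltr0n.
have AP x : x \in A -> x \in S /\ forall i, i \in I -> (5 * h + s)%:R <= `|x 0 i|.
  by move/large_coordsP.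
have [->|[x0 x0A]] := fset_0Vmem A.
  by rewrite cardfs0 !mulr_ge0 ?expR_ge0.
(* The freed mass [m * h] is at most the l1 norm of a point of [A], hence at most [h * d]. *)
have md : (m <= d)%N.
  have [x0S x0I] := AP _ x0A.
  rewrite -(leq_pmul2r h0); apply: (leq_trans mh); rewrite -(ler_nat R).
  apply: (@le_trans _ _ (l1norm x0)); last first.
    by apply: (le_trans (SK _ x0S)); rewrite natrM mulrC ler_wpM2l // ltW.
  rewrite natrM mulr_natl -sumr_const big_mkcond /=.
  apply: ler_sum => i _; case: ifP => // iI.
  by apply: le_trans (x0I i iI); rewrite ler_nat leq_addl.
(* The profile is at most 3/2, so the expected number of raised coordinates is at most [m / 2], as
   [bernoulli_card_le] requires; [m <= d] keeps the probabilities below 1. *)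
pose th : R := m%:R / (3 * d%:R).
have th0 : 0 <= th by rewrite divr_ge0 // mulr_ge0 // ltW.
have th1 : th <= 3^-1.
  rewrite ler_pdivrMr ?mulr_gt0 // mulrA mulVf ?mul1r ?ler_nat //.
have thd : th * d%:R = m%:R / 3 by rewrite /th; field; rewrite gt_eqF.
pose p (x : 'rV[R]_d) i := th * bump_profile (`|x 0 i| / h%:R).
(* The probability with which a coordinate was raised, expressed through its value after the raise
   by [h]. *)
pose q (x : 'rV[R]_d) i :=
  if 1 <= `|x 0 i| / h%:R then th * bump_profile (`|x 0 i| / h%:R - 1) else 0.
have p0 x i : 0 <= p x i by rewrite mulr_ge0 // bump_profile_ge0.
have ph x i : p x i <= th * (3 / 2) by rewrite ler_wpM2l // bump_profile_le.
have p1 x i : p x i <= 1 by apply: (le_trans (ph x i)); lra.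
have q0 x i : 0 <= q x i by rewrite /q; case: ifP => // _; rewrite mulr_ge0 // bump_profile_ge0.
pose D (x : 'rV[R]_d) J := [forall j in J, `|x 0 j| < 4 * h%:R] && (#|J| <= m)%N.
pose w (x : 'rV[R]_d) J := \prod_i (if i \in J then p x i else 1 - p x i).
pose w' (x : 'rV[R]_d) J := \prod_i (if i \in J then q x i else 1 - p x i).
pose r J := shift I J s h.
have DI x J i : x \in A -> D x J -> i \in I -> i \notin J.
  move=> /AP[_ xI] /andP[/forallP xJ _] iI; apply/negP=> iJ.
  have := xJ i; rewrite iJ /= ltNge => /negP; apply.
  apply: le_trans (xI i iI); rewrite natrD natrM.
  by have : 0 <= s%:R :> R by []; lra.
have nE x J i : x \in A -> D x J ->
    `|push_row (r J) finset.set0 x 0 i| = `|x 0 i| + r J i.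
  move=> xA xJ; apply: normr_push_row; rewrite /r /shift; case: ifP => iI.
    have [_ /(_ i iI)] := AP _ xA; rewrite natrD => xi.
    by rewrite subr_ge0; apply: le_trans xi; rewrite lerDr.
  by case: ifP => _; rewrite addr_ge0.
have inj J x x' : x \in A -> x' \in A -> D x J -> D x' J ->
    push_row (r J) finset.set0 x = push_row (r J) finset.set0 x' -> x = x'.
  move=> xA x'A xJ x'J e; apply/rowP => i.
  have [iI|iI] := boolP (i \in I).
    have rI y : y \in A -> 0 < `|y 0 i| + r J i.
      move=> /AP[_ /(_ i iI)]; rewrite /r /shift iI natrD subr_gt0.
      by apply: lt_le_trans; rewrite ltrDr ltr0n muln_gt0.
    by apply: (push_row_inj (rI x xA) (rI x' x'A) e).
  have [iJ|iJ] := boolP (i \in J).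
    have rJ (y : 'rV[R]_d) : 0 < `|y 0 i| + r J i.
      by rewrite /r /shift (negbTE iI) iJ ltr_wpDl.
    by apply: (push_row_inj (rJ x) (rJ x') e).
  move/rowP/(_ i): e; rewrite !mxE inE !mul1r /r /shift (negbTE iI) (negbTE iJ).
  by rewrite /push subr0 addr0 subr0 addr0 !if_same.
have step x J : x \in A -> D x J ->
    push_row (r J) finset.set0 x \in S /\ w x J <= w' (push_row (r J) finset.set0 x) J.
  move=> xA xJ; have [xS xI] := AP _ xA; split.
    apply: (push_row_lattice (b := (5 * h)%N) _ xS xI).
      move=> j jJ; move/andP: xJ => [/forallP/(_ j)]; rewrite jJ /= natrM => xj _.
      by lra.
    apply: leq_trans mh; rewrite leq_mul2r; apply/orP; right.
    by have /andP[] := xJ.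
  rewrite le_eqVlt; apply/orP; left; apply/eqP; apply: eq_bigr => i _.
  rewrite /q /p nE //.
  case: ifP => iJ.
    have iI : i \notin I by apply: contraTN iJ => iI; apply: (DI x J i xA xJ iI).
    rewrite /r /shift (negbTE iI) iJ mulrDl divff ?gt_eqF // lerDr.
    have z0 : 0 <= `|x 0 i| / h%:R by rewrite divr_ge0 // ltW.
    by rewrite z0 addrK.
  congr (1 - th * _); rewrite /r /shift iJ; case: ifP => iI; last by rewrite addr0.
  have [_ /(_ i iI)] := AP _ xA; rewrite natrD natrM => xi.
  have s0 : 0 <= s%:R :> R by [].
  by rewrite !bump_profile_eq0 // ler_pdivlMr //; lra.
have lower x : x \in A -> 2^-1 <= \sum_(J | D x J) w x J.
  move=> xA; have := @bernoulli_card_le R _ (p x) m (p0 x) (p1 x).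
  have : \sum_i p x i <= m%:R / 2.
    apply: (@le_trans _ _ (\sum_(i < d) th * (3 / 2))); first exact: ler_sum.
    by rewrite sumr_const card_ord -mulr_natr; lra.
  move=> h1 /(_ h1) /le_trans; apply.
  (* Sets [J] of size at most [m] that violate [D x] contain a coordinate of size at least [4 * h],
     so their weight is 0. *)
  rewrite (bigID (D x)) /= [leRHS](eq_bigl (fun J : {set 'I_d} => (#|J| <= m)%N && D x J)).
    rewrite gerDl le_eqVlt; apply/orP; left; apply/eqP/big1 => J.
    rewrite /D => /andP[->]; rewrite andbT negb_forall => /existsP[j].
    rewrite negb_imply -leNgt => /andP[jJ xj].
    by rewrite /w (bigD1 j) //= jJ /p bump_profile_eq0 ?mulr0 ?mul0r // ler_pdivlMr.
  by move=> J; rewrite /D; case: (#|J| <= m)%N; rewrite ?andbT ?andbF.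
(* The sum is the product of the [q y i + (1 - p y i)]. By [bump_profile_step] its logarithm is at
   most [th * (d / 2 - d)], since the [|y 0 i| / h] add up to at most [d]; this is [- m / 6]. *)
have upper y : y \in S -> \sum_J w' y J <= expR (- (m%:R / 6)).
  move=> yS; rewrite -prodrD_subsets.
  apply: (@le_trans _ _ (\prod_i expR (th * (`|y 0 i| / h%:R / 2 - 1)))).
    apply: ler_prod => i _; apply/andP; split.
      by rewrite addr_ge0 // subr_ge0.
    apply: le_trans (expR_ge1Dx _).
    have z0 : 0 <= `|y 0 i| / h%:R by rewrite divr_ge0 // ltW.
    have := ler_wpM2l th0 (bump_profile_step z0).
    by rewrite /q /p; case: ifP => _; lra.
  rewrite -expR_sum ler_expR -mulr_sumr sumrB -!mulr_suml sumr_const card_ord.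
  have := SK _ yS; rewrite /l1norm => yK.
  have yd : (\sum_i `|y 0 i|) / h%:R <= d%:R.
    rewrite ler_pdivrMr // mulrC; apply: (le_trans yK).
    by rewrite ler_wpM2r // ltW.
  have := ler_wpM2l th0 yd; rewrite thd; lra.
have := @double_count R _ _ _ A S D (fun J => push_row (r J) finset.set0) w w'.
have w'0 J y : y \in S -> 0 <= w' y J.
  by move=> _; apply: prodr_ge0 => i _; case: ifP => _ //; rewrite subr_ge0.
move=> /(_ w'0 inj step) dc.
have dc1 : (2^-1 : R) * (#|` A|%:R : R) <= expR (- (m%:R / 6)) * (#|` S|%:R : R).
  apply: (@le_trans _ _ (\sum_(x <- A) \sum_(J | D x J) w x J)).
    rewrite mulr_natr -sum1_size -sumrMnr big_seq [leRHS]big_seq.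
    by apply: ler_sum => x xA; rewrite mulr1n; apply: lower.
  apply: (le_trans dc).
  rewrite mulr_natr -sum1_size -sumrMnr big_seq [leRHS]big_seq.
  by apply: ler_sum => x xA; rewrite mulr1n; apply: upper.
by lra.
Qed.
End LargeCoordinates.

(** * Points with prescribed large coordinates: the sparse case *)

Lemma leq_binM_exp n N m : (n <= N)%N ->
  ('C(n, m) * N ^ m <= 'C(N, m) * n ^ m)%N.
Proof.
move=> nN; rewrite -(leq_pmul2r (fact_gt0 m)).
rewrite [leqLHS]mulnAC [leqRHS]mulnAC !bin_ffact.
(* Falling factorials are compared factor by factor: [(n - m) * N <= (N - m) * n]. *)
elim: m => [|m IH]; first by rewrite !ffactn0.
rewrite !ffactnSr !expnSr [leqLHS]mulnACA [leqRHS]mulnACA leq_mul //.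
by rewrite !mulnBl [(N * n)%N]mulnC leq_sub2l // leq_mul2l nN orbT.
Qed.

Section SparseCase.
Variables (R : realType) (d : nat) (G : set 'rV[R]_d).
Hypothesis HG : one_symmetric_bodies R d G.
Implicit Types I J E : {set 'I_d}.

Lemma card_support_le n (x : 'rV[R]_d) : (forall i, x 0 i \is a Num.int) ->
  l1norm x <= n%:R -> (#|[set i | (x 0 i != 0)%R]%SET| <= n)%N.
Proof.
move=> xZ xn; rewrite -(ler_nat R); apply: le_trans xn.
rewrite -sumr_const big_mkcond /=; apply: ler_sum => i _; rewrite inE.
by case: eqVneq => //= x0; rewrite norm_intr_ge1.
Qed.

(** Lowering [I] by [s] pays for exactly [#|I| * s] new entries equal to 1 or -1. The lowered
    coordinates stay at least 1 in absolute value, so the separating level is 1. *)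
Lemma card_large_coords_exp_ratio I (s n : nat) :
  (n + n <= d)%N ->
  (forall x : 'rV[R]_d, x \in lattice_points G -> l1norm x <= n%:R) ->
  (#|` large_coords G I s.+1%:R| * d ^ (#|I| * s)
    <= #|` lattice_points G| * n ^ (#|I| * s))%N.
Proof.
move=> nd Sn; set A := large_coords _ _ _; set S := lattice_points G.
set m := (#|I| * s)%N.
have AP x : x \in A -> x \in S /\ forall i, i \in I -> (1 + s)%:R <= `|x 0 i|.
  by move/large_coordsP.
have SZ (x : 'rV[R]_d) : x \in S -> forall i, x 0 i \is a Num.int.
  by rewrite mem_lattice_points // inE => -[].
have [->|[x0 x0A]] := fset_0Vmem A; first by rewrite cardfs0.
have mn : (m <= n)%N.
  have [x0S x0I] := AP _ x0A.
  rewrite -(ler_nat R); apply: le_trans (Sn _ x0S).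
  rewrite natrM mulr_natl -sumr_const big_mkcond /=.
  apply: ler_sum => i _; case: ifP => // iI.
  by apply: le_trans (x0I i iI); rewrite ler_nat leq_addl.
pose Z (x : 'rV[R]_d) := [set i | (x 0 i == 0)%R]%SET.
pose Ng (x : 'rV[R]_d) := [set i | (x 0 i < 0)%R]%SET.
pose D (x : 'rV[R]_d) (p : {set 'I_d} * {set 'I_d}) :=
  ((p.1 \subset Z x) && (#|p.1| == m)) && (p.2 \subset p.1).
(* Given the image [y] and [J], the set [E] of minus signs is forced; only the choice of [J] in the
   support of [y] remains. *)
pose w' (y : 'rV[R]_d) (p : {set 'I_d} * {set 'I_d}) : R :=
  (((p.1 \subset ~: Z y) && (#|p.1| == m)) && (p.2 == p.1 :&: Ng y)%SET)%:R.
pose phi (p : {set 'I_d} * {set 'I_d}) := push_row (shift R I p.1 s 1) p.2.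
have inj p x x' : x \in A -> x' \in A -> D x p -> D x' p ->
    phi p x = phi p x' -> x = x'.
  case: p => J E xA x'A /andP[/andP[/fintype.subsetP xJ _] /fintype.subsetP EJ].
  move=> /andP[/andP[/fintype.subsetP x'J _] _] e; apply/rowP => i.
  have [iI|iI] := boolP (i \in I).
    have rI y : y \in A -> 0 < `|y 0 i| + shift R I J s 1 i.
      move=> /AP[_ /(_ i iI)]; rewrite /shift iI natrD subr_gt0.
      by apply: lt_le_trans; rewrite ltrDr.
    by apply: (push_row_inj (rI x xA) (rI x' x'A) e).
  have [iJ|iJ] := boolP (i \in J).
    by have := xJ i iJ; have := x'J i iJ; rewrite !inE => /eqP-> /eqP->.
  move/rowP/(_ i): e; rewrite !mxE /= (negbTE (contra (EJ i) iJ)) !mul1r.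
  by rewrite /shift (negbTE iI) (negbTE iJ) /push subr0 addr0 subr0 addr0 !if_same.
have step x p : x \in A -> D x p -> phi p x \in S /\ 1 <= w' (phi p x) p.
  case: p => J E xA /andP[/andP[/fintype.subsetP xJ mJ] /fintype.subsetP EJ].
  have [xS xI] := AP _ xA.
  have xJ0 j : j \in J -> x 0 j = 0 by move/xJ; rewrite inE => /eqP.
  split.
    apply: (push_row_lattice HG _ xS xI); last by rewrite muln1 (eqP mJ).
    by move=> j jJ; rewrite xJ0 // normr0 add0r.
  have yJ j : j \in J -> phi (J, E) x 0 j = (-1) ^+ (j \in E).
    move=> jJ; rewrite mxE /= /shift jJ; case: ifP => jI.
      have [_ /(_ j jI)] := AP _ xA; rewrite xJ0 // normr0 lern0. 
      by rewrite addn_eq0.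
    by rewrite xJ0 // /push lexx add0r mulr1.
  suff -> : w' (phi (J, E) x) (J, E) = 1 by [].
  rewrite /w' /= mJ andbT; case: andP => // -[]; split.
    by apply/fintype.subsetP => j jJ; rewrite !inE yJ // signr_eq0.
  apply/eqP/setP => j; rewrite !inE; case: (boolP (j \in J)) => [jJ|jJ] /=.
    rewrite yJ //; case: (j \in E); first by rewrite expr1 ltrN10.
    by rewrite expr0 ltr10.
  by apply: contraNF jJ; apply: EJ.
have lower x : x \in A -> ('C(d - n, m) * 2 ^ m)%:R <= \sum_(p | D x p) 1 :> R.
  move=> xA; rewrite /D -(pair_big_dep
    (fun J : {set 'I_d} => (J \subset Z x) && (#|J| == m))
    (fun J E : {set 'I_d} => E \subset J) (fun _ _ => 1)) /=.
  apply: (@le_trans _ _ (\sum_(J : {set 'I_d} | (J \subset Z x) && (#|J| == m)) (2 ^ m)%:R)).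
    rewrite sumr_const -mulrnA ler_nat mulnC leq_mul2l; apply/orP; right.
    have -> : #|[pred J : {set 'I_d} | (J \subset Z x) && (#|J| == m)]| = 'C(#|Z x|, m).
      by rewrite -cards_draws; apply: eq_card => J; rewrite !inE.
    apply: leq_bin2l; have [xS _] := AP _ xA.
    have := card_support_le (SZ _ xS) (Sn _ xS).
    have -> : [set i | (x 0 i != 0)%R]%SET = (~: Z x)%SET.
      by apply/setP => i; rewrite !inE.
    have := cardsC (Z x); rewrite card_ord; lia.
  apply: ler_sum => J /andP[_ /eqP <-]; rewrite sumr_const ler_nat.
  by rewrite -card_powerset; apply/eq_leq/eq_card => E; rewrite powersetE.
have upper y : y \in S -> \sum_p w' y p <= ('C(n, m))%:R.
  move=> yS; rewrite (eq_bigr (fun p : {set 'I_d} * {set 'I_d} =>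
     if (((p.1 \subset ~: Z y) && (#|p.1| == m)) && (p.2 == p.1 :&: Ng y))%SET
     then 1 else 0)); last by move=> p _; rewrite /w'; case: ifP.
  rewrite -big_mkcond /= -(pair_big_dep
    (fun J : {set 'I_d} => (J \subset ~: Z y)%SET && (#|J| == m))
    (fun J E : {set 'I_d} => (E == J :&: Ng y)%SET) (fun _ _ => 1)) /=.
  rewrite (eq_bigr (fun=> 1)); last by move=> J _; rewrite big_pred1_eq.
  rewrite sumr_const ler_nat.
  have -> : #|[pred J : {set 'I_d} | (J \subset ~: Z y)%SET && (#|J| == m)]| = 'C(#|(~: Z y)%SET|, m).
    by rewrite -cards_draws; apply: eq_card => J; rewrite !inE.
  apply: leq_bin2l; have := card_support_le (SZ _ yS) (Sn _ yS).
  suff -> : [set i | (y 0 i != 0)%R]%SET = (~: Z y)%SET by [].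
  by apply/setP => i; rewrite !inE.
have w'0 p y : y \in S -> 0 <= w' y p by [].
have dc := double_count w'0 inj step.
have {dc} dc : (#|` A| * ('C(d - n, m) * 2 ^ m) <= #|` S| * 'C(n, m))%N.
  rewrite -(ler_nat R).
  apply: (@le_trans _ _ (\sum_(x <- A) \sum_(p | D x p) 1)).
    rewrite natrM mulr_natl -sum1_size -sumrMnr big_seq [leRHS]big_seq.
    by apply: ler_sum => x xA; rewrite mulr1n; apply: lower.
  apply: (le_trans dc).
  rewrite natrM mulr_natl -sum1_size -sumrMnr big_seq [leRHS]big_seq.
  by apply: ler_sum => x xA; rewrite mulr1n; apply: upper.
have nN : (n <= d - n)%N by lia.
have C0 : (0 < 'C(d - n, m))%N by rewrite bin_gt0; lia.
rewrite -(leq_pmul2r C0).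
(* Since [d <= 2 * (d - n)], the factor [2 ^ m] from the signs turns [(d - n) ^ m] into [d ^ m]. *)
apply: (@leq_trans (#|` A| * ('C(d - n, m) * 2 ^ m) * (d - n) ^ m)).
  rewrite -!mulnA leq_mul2l mulnC leq_mul2l -expnMn.
  case: (m) => [|m']; first by rewrite !orbT.
  by rewrite leq_exp2r // (_ : (d <= 2 * (d - n))%N) ?orbT //; lia.
apply: (@leq_trans (#|` S| * 'C(n, m) * (d - n) ^ m)); first by rewrite leq_mul2r dc orbT.
by rewrite -!mulnA leq_mul2l [(n ^ _ * _)%N]mulnC leq_binM_exp ?orbT.
Qed.
End SparseCase.

(** * Threshold levels and the choice of the set of large coordinates *)

Lemma sum_le_by_levels (R : numDomainType) (T : finType) (f : T -> R)
    (b : nat -> R) (A : {set T}) :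
  (forall I : {set T}, I \subset A -> I != finset.set0 ->
     exists2 i, i \in I & f i <= b #|I|) ->
  \sum_(i in A) f i <= \sum_(1 <= k < #|A|.+1) b k.
Proof.
have [n] := ubnP #|A|; elim: n A => // n IH A An H.
have [->|A0] := eqVneq A finset.set0.
  by rewrite cards0 big_set0 big_geq.
(* The element found in [A] itself is charged to level [#|A|]; removing it leaves the lower
   levels. *)
have [i iA fi] := H A (fintype.subxx _) A0.
have cA : #|A| = #|A :\ i|.+1 by rewrite (cardsD1 i) iA.
rewrite (bigD1 i) //= cA big_nat_recr //= addrC; rewrite cA in fi; rewrite lerD //.
have -> : \sum_(j in A | j != i) f j = \sum_(j in A :\ i) f j.
  by apply: eq_bigl => j; rewrite in_setD1 andbC.
apply: IH; first by rewrite -ltnS -cA.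
by move=> I IA; apply: H; apply: fintype.subset_trans IA (subsetDl _ _).
Qed.

Section Levels.
Variable R : realType.

(** Multiplied by [k], the first term is the square root of [N] whatever [k] is, which produces the
    square root in the exponents; the second term is the one occurring in [bin_le_expR]. *)
Definition level (N k : nat) : R :=
  Num.sqrt N%:R / k%:R + Num.sqrt (Num.sqrt (N%:R / k%:R)).

Lemma sum_inv_sqr_le n : \sum_(1 <= k < n.+1) (k%:R ^+ 2)^-1 <= 2 :> R.
Proof.
case: n => [|n]; first by rewrite big_geq.
(* The sharper bound makes the induction a telescoping sum. *)
apply: (@le_trans _ _ (2 - n.+1%:R^-1)); last by rewrite gerBl invr_ge0.
elim: n => [|n IH]; first by rewrite big_nat1 expr1n invr1; lra.
rewrite big_nat_recr //=; have a0 : 0 < n.+1%:R :> R by rewrite ltr0n.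
have -> : n.+2%:R = n.+1%:R + 1 :> R by rewrite natr1.
move: IH a0; move: (n.+1%:R : R) => a IH a0.
have a1 : 0 < a + 1 by rewrite addr_gt0.
suff : ((a + 1) ^+ 2)^-1 <= a^-1 - (a + 1)^-1 by lra.
have -> : a^-1 - (a + 1)^-1 = (a * (a + 1))^-1.
  by field; rewrite !gt_eqF.
rewrite lef_pV2 ?posrE ?mulr_gt0 ?exprn_gt0 // expr2 ler_wpM2r ?(ltW a1) //.
by rewrite lerDl.
Qed.

Lemma sum_inv_sqrt_le n :
  \sum_(1 <= k < n.+1) (Num.sqrt k%:R)^-1 <= 2 * Num.sqrt n%:R :> R.
Proof.
elim: n => [|n IH]; first by rewrite big_geq // sqrtr0 mulr0.
rewrite big_nat_recr //=.
have a0 : 0 < Num.sqrt n.+1%:R :> R by rewrite sqrtr_gt0 ltr0n.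
have b0 : 0 <= Num.sqrt n%:R :> R by [].
have aE : Num.sqrt n.+1%:R ^+ 2 = n.+1%:R :> R by rewrite sqr_sqrtr.
have bE : Num.sqrt n%:R ^+ 2 = n%:R :> R by rewrite sqr_sqrtr.
have E : Num.sqrt n.+1%:R ^+ 2 = Num.sqrt n%:R ^+ 2 + 1 :> R by rewrite aE bE natr1.
have : (Num.sqrt n.+1%:R)^-1 <= 2 * (Num.sqrt n.+1%:R - Num.sqrt n%:R) :> R; last by lra.
rewrite -[leLHS]mul1r ler_pdivrMr //.
move: E a0 b0; move: (Num.sqrt n%:R : R) => b; move: (Num.sqrt n.+1%:R : R) => a.
move=> E a0 b0; nra.
Qed.

(** After [(a + b) ^+ 2 <= 2 * a ^+ 2 + 2 * b ^+ 2], each of the two terms contributes at most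
    [4 * N]. *)
Lemma sum_level_sqr_le N :
  \sum_(1 <= k < N.+1) level N k ^+ 2 <= 8 * N%:R.
Proof.
have N0 : 0 <= N%:R :> R by [].
apply: (@le_trans _ _ (\sum_(1 <= k < N.+1)
   (2 * N%:R * (k%:R ^+ 2)^-1 + 2 * Num.sqrt N%:R * (Num.sqrt k%:R)^-1))).
  apply: ler_sum_nat => k /andP[k0 _]; rewrite /level.
  set a := Num.sqrt N%:R / k%:R; set b := Num.sqrt (Num.sqrt _).
  have aE : a ^+ 2 = N%:R * (k%:R ^+ 2)^-1 by rewrite expr_div_n sqr_sqrtr.
  have bE : b ^+ 2 = Num.sqrt N%:R * (Num.sqrt k%:R)^-1.
    by rewrite sqr_sqrtr ?sqrtr_ge0 // sqrtrM // sqrtrV.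
  rewrite -!mulrA -aE -bE; have := sqr_ge0 (a - b); nra.
rewrite big_split /= -!mulr_sumr.
have h1 := ler_wpM2l N0 (sum_inv_sqr_le N).
have h2 := ler_wpM2l (sqrtr_ge0 (N%:R : R)) (sum_inv_sqrt_le N).
have h3 : Num.sqrt N%:R * Num.sqrt N%:R = N%:R :> R by rewrite -expr2 sqr_sqrtr.
move: h2; rewrite mulrCA h3; lra.
Qed.

(** Otherwise every nonempty subset of the support has a coordinate below its level, and
    [sum_le_by_levels] bounds the sum of squares by [8 * c ^+ 2 * N], a contradiction. *)
Lemma exists_large_coords (T : finType) (x : T -> R) (N : nat) (c : R) :
  (0 < N)%N -> 0 < c -> (#|[set i | (x i != 0)%R]%SET| <= N)%N ->
  16 * c ^+ 2 * N%:R <= \sum_i x i ^+ 2 ->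
  exists I : {set T}, (0 < #|I| <= N)%N /\
    forall i, i \in I -> c * level N #|I| <= `|x i|.
Proof.
move=> N0 c0; set A := [set i | _]%SET => AN xN.
have l0 k : 0 <= level N k by rewrite addr_ge0 // divr_ge0.
apply: contrapT => H.
have : \sum_(i in A) x i ^+ 2 <=
    \sum_(1 <= k < #|A|.+1) (c * level N k) ^+ 2.
  apply: sum_le_by_levels => I IA I0.
  apply: contrapT => H'; apply: H; exists I; split.
    by rewrite card_gt0 I0 (leq_trans (subset_leq_card IA)).
  move=> i iI; rewrite leNgt; apply/negP => xi; apply: H'; exists i => //.
  have cl0 : 0 <= c * level N #|I| by rewrite mulr_ge0 // ltW.
  rewrite -[leLHS]real_normK ?num_real //.
  by apply: lerXn2r; rewrite ?nnegrE //; apply: ltW.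
apply/negP; rewrite -ltNge.
have -> : \sum_(i in A) x i ^+ 2 = \sum_i x i ^+ 2.
  rewrite [LHS]big_mkcond; apply: eq_bigr => i _; rewrite inE.
  by case: eqVneq => //= ->; rewrite expr0n.
apply: lt_le_trans xN.
apply: (@le_lt_trans _ _ (\sum_(1 <= k < N.+1) (c * level N k) ^+ 2)).
  rewrite [leRHS](big_cat_nat _ (n := #|A|.+1)) //= lerDl.
  by apply: sumr_ge0 => k _; apply: sqr_ge0.
under eq_bigr do rewrite exprMn.
rewrite -mulr_sumr.
have c2 : 0 < c ^+ 2 by rewrite exprn_gt0.
have N0' : 0 < N%:R :> R by rewrite ltr0n.
have := ler_wpM2l (ltW c2) (sum_level_sqr_le N).
have := mulr_gt0 c2 N0'; lra.
Qed.

(** Start from [d ^ k / k!], split off [k ^ k / k! <= expR k], and use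
    [n / k = r ^+ 4 <= expR (4 * (r - 1))] for the fourth root [r] of [n / k]. *)
Lemma bin_le_expR (d n k : nat) : (0 < d)%N -> (0 < n)%N -> (0 < k)%N ->
  'C(d, k)%:R <= expR (k%:R * (4 * Num.sqrt (Num.sqrt (n%:R / k%:R)) - 3)) *
                 (d%:R / n%:R) ^+ k :> R.
Proof.
move=> d0 n0 k0; set r := Num.sqrt _.
have dR : 0 < d%:R :> R by rewrite ltr0n.
have nR : 0 < n%:R :> R by rewrite ltr0n.
have kR : 0 < k%:R :> R by rewrite ltr0n.
have fR : 0 < k`!%:R :> R by rewrite ltr0n fact_gt0.
have r4 : n%:R / k%:R = r ^+ 4.
  by rewrite (exprM r 2 2) !sqr_sqrtr // divr_ge0.
have rexp : n%:R / k%:R <= expR (4 * r - 4).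
  have -> : 4 * r - 4 = 4%:R * (r - 1) by ring.
  rewrite r4 expRM_natl lerXn2r ?nnegrE ?expR_ge0 ?sqrtr_ge0 //.
  by have := expR_ge1Dx (r - 1); lra.
have kk : k%:R ^+ k / k`!%:R <= expR k%:R :> R.
  have := @expR_ge1Dxn R k%:R k.-1 (ltW kR); rewrite prednK //; lra.
apply: (@le_trans _ _ (d%:R ^+ k / k`!%:R)).
  rewrite ler_pdivlMr // -natrM -natrX ler_nat bin_ffact.
  by elim: (k) => // j IH; rewrite ffactnSr expnSr leq_mul // leq_subr.
have -> : d%:R ^+ k / k`!%:R = (k%:R ^+ k / k`!%:R) * (n%:R / k%:R) ^+ k * (d%:R / n%:R) ^+ k :> R.
  rewrite !expr_div_n; field; rewrite !expf_neq0 ?gt_eqF //.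
rewrite ler_wpM2r ?exprn_ge0 ?divr_ge0 //.
have -> : k%:R * (4 * r - 3) = k%:R + k%:R * (4 * r - 4) by ring.
rewrite expRD expRM_natl ler_pM ?exprn_ge0 ?divr_ge0 //.
by rewrite lerXn2r ?nnegrE ?expR_ge0 ?divr_ge0.
Qed.

End Levels.

(** * Union bound over the sets of large coordinates *)

Lemma card_fset_union_le (T : choiceType) (P : finType) (Q : pred P)
    (B : {fset T}) (A : P -> {fset T}) :
  (forall x, x \in B -> exists2 p, Q p & x \in A p) ->
  (#|` B| <= \sum_(p | Q p) #|` A p|)%N.
Proof.
move=> BA; rewrite -sum1_size.
apply: (@leq_trans (\sum_(x <- B) \sum_(p | Q p) (x \in A p))).
  rewrite big_seq [leqRHS]big_seq; apply: leq_sum => x /BA[p Qp xA].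
  by rewrite (bigD1 p) //= xA.
rewrite exchange_big /=; apply: leq_sum => p _.
have -> : (\sum_(x <- B) (x \in A p) = count (mem (A p)) B)%N.
  by rewrite -sum1_count [RHS]big_mkcond; apply: eq_bigr => x _ /=; case: ifP.
rewrite -size_filter; apply: uniq_leq_size; first by rewrite filter_uniq.
by move=> x; rewrite mem_filter => /andP[].
Qed.

Section Union.
Variables (R : realType) (d : nat) (G : set 'rV[R]_d).

Lemma sum_half_powers_le (N : nat) : \sum_(1 <= k < N.+1) 2^-1 ^+ k <= 1 :> R.
Proof.
apply: (@le_trans _ _ (1 - 2^-1 ^+ N)); last by rewrite gerBl exprn_ge0.
elim: N => [|N IH]; first by rewrite big_geq // expr0 subrr.
by rewrite big_nat_recr //= exprS; lra.
Qed.

(** The sets [I] of size [k] number ['C(d, k)] and together contribute at most [M / 2 ^ k]; the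
    geometric series sums to at most [M]. *)
Lemma card_large_l2_le (N : nat) (c M : R) :
  (0 < N)%N -> (N <= d)%N -> 0 < c -> 0 <= M ->
  (forall x : 'rV[R]_d, x \in lattice_points G ->
     (#|[set i | (x 0 i != 0)%R]%SET| <= N)%N) ->
  (forall I : {set 'I_d}, (0 < #|I| <= N)%N ->
     'C(d, #|I|)%:R * #|` large_coords G I (c * level R N #|I|)|%:R
     <= 2^-1 ^+ #|I| * M) ->
  #|` [fset x : 'rV[R]_d in lattice_points G |
        (16 * c ^+ 2 * N%:R <= \sum_i x 0 i ^+ 2)%R]%fset|%:R <= M.
Proof.
case: N => // N N0 Nd c0 M0 SN SI; set B := [fset x in _ | _]%fset.
pose P (I : {set 'I_d}) := (0 < #|I| <= N.+1)%N.
have : (#|` B| <= \sum_(I | P I) #|` large_coords G I (c * level R N.+1 #|I|)|)%N.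
  apply: card_fset_union_le => x; rewrite !inE /= => /andP[xS xB].
  have [I [PI xI]] := exists_large_coords N0 c0 (SN x xS) xB.
  by exists I => //; apply/large_coordsP.
rewrite -(ler_nat R) => /le_trans; apply; rewrite natr_sum.
apply: (@le_trans _ _ (\sum_(I | P I) 2^-1 ^+ #|I| * M / 'C(d, #|I|)%:R)).
  apply: ler_sum => I PI; rewrite ler_pdivlMr ?ltr0n; first by rewrite mulrC SI.
  by rewrite bin_gt0; case/andP: PI => _ /leq_trans; apply.
apply: (@le_trans _ _ (\sum_(1 <= k < N.+2) 2^-1 ^+ k * M)); last first.
  by rewrite -mulr_suml ler_piMl // sum_half_powers_le.
rewrite big_add1 /= big_mkord.
(* Class [k] of the partition holds the sets of size [k.+1], hence the predecessor. *)
rewrite [leLHS](partition_big (fun I : {set 'I_d} => inord #|I|.-1 : 'I_N.+1) xpredT) //=.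
apply: ler_sum => k _.
rewrite (eq_bigl (fun I : {set 'I_d} => #|I| == k.+1)); last first.
  move=> I; apply/andP/eqP => [[/andP[I0 IN] /eqP <-]|Ik].
    by rewrite inordK prednK.
  by rewrite /P Ik ltn_ord; split=> //; apply/eqP/val_inj; rewrite /= inordK.
rewrite (eq_bigr (fun=> 2^-1 ^+ k.+1 * M / 'C(d, k.+1)%:R)); last by move=> I /eqP ->.
rewrite sumr_const.
have -> : #|[pred I : {set 'I_d} | #|I| == k.+1]| = 'C(d, k.+1).
  by rewrite -[in RHS](card_ord d) -card_draws; apply: eq_card => I; rewrite !inE.
by rewrite -[leLHS]mulr_natr divfK // pnatr_eq0 -lt0n bin_gt0 (leq_trans (ltn_ord k)).
Qed.

End Union.

(** * Choice of constants and the two regimes *)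

Lemma sparse_exponent_le (R : realFieldType) (t l q k r s : R) :
  1152 <= t -> 2^-1 <= l -> 0 <= q -> 1 <= k -> 1 <= r ->
  t / 8 * (q + k * r) <= k * s ->
  k * (4 * r - 3) + k * l + - (k * s * l) <= k * - 3 + - (288^-1 * t * q * l).
Proof.
(* In the application [l] is [- ln K], [q] is the square root of [n] and [r] the fourth root of
   [n / k]. The part [t / 8 * k * r * l] of the gain outweighs [4 * k * r + k * l], because
   [2 * l >= 1]. *)
move=> t0 l0 q0 k1 r1 H.
have lp : 0 <= l by lra.
have kr0 : 0 <= k * r by rewrite mulr_ge0 //; lra.
have h1 : t * (q * l) + t * (k * r * l) <= 8 * (k * s * l).
  by have := ler_wpM2r lp H; lra.
have h2 : 1152 * (k * r * l) <= t * (k * r * l) by rewrite ler_wpM2r // mulr_ge0.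
have h3 : k * r <= 2 * (k * r * l) by have := ler_wpM2l kr0 l0; lra.
have h4 : k * l <= k * r * l by rewrite ler_wpM2r // ler_peMr //; lra.
have h5 : 0 <= t * (q * l) by rewrite mulr_ge0 ?mulr_ge0 //; lra.
have -> : 288^-1 * t * q * l = 288^-1 * (t * (q * l)) by rewrite !mulrA.
rewrite mulrBr [k * (4 * r)]mulrCA.
move: (t * (q * l)) (t * (k * r * l)) h1 h2 h5 => A B h1 h2 h5.
move: (k * s * l) (k * l) (k * r) kr0 h1 h2 h3 h4 => Y Z W kr0 h1 h2 h3 h4.
lra.
Qed.

Section Conclusion.
Variables (R : realType) (d : nat) (G : set 'rV[R]_d).
Hypotheses (d0 : (0 < d)%N) (HG : one_symmetric_bodies R d G).

Lemma set_card_l2norm_ge_le (u c n : R) : 0 <= u ->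
  16 * c ^+ 2 * n = u ^+ 2 * d%:R ->
  (set_card [set x | (G `&` integer_lattice R d) x /\
                     (u <= l2norm x / Num.sqrt d%:R)%R] <=
   #|` [fset x : 'rV[R]_d in lattice_points G |
        (16 * c ^+ 2 * n <= \sum_i x 0 i ^+ 2)%R]%fset|)%N.
Proof.
move=> u0 cE; rewrite (set_card_lattice HG (fun x => u <= l2norm x / Num.sqrt d%:R)%R).
apply: fsubset_leq_card; apply/fsubsetP => x; rewrite !inE /= => /andP[-> /=].
have sd : 0 < Num.sqrt d%:R :> R by rewrite sqrtr_gt0 ltr0n.
rewrite ler_pdivlMr // => h; rewrite cE.
have s0 : 0 <= \sum_i x 0 i ^+ 2 by apply: sumr_ge0 => i _; apply: sqr_ge0.
have : (u * Num.sqrt d%:R) ^+ 2 <= l2norm x ^+ 2.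
  by apply: lerXn2r; rewrite ?nnegrE ?mulr_ge0 // ?sqrtr_ge0.
by rewrite exprMn !sqr_sqrtr.
Qed.

Lemma level_ge1 (N k : nat) : (0 < k <= N)%N -> 1 <= Num.sqrt (Num.sqrt (N%:R / k%:R)) :> R.
Proof.
move=> /andP[k0 kN]; rewrite -[leLHS]sqrtr1 ler_wsqrtr // -[leLHS]sqrtr1 ler_wsqrtr //.
by rewrite ler_pdivlMr ?ltr0n // mul1r ler_nat.
Qed.

(** Turns the surplus [- 3 * k] of [bin_le_expR] into the geometric weight of [card_large_l2_le];
    the factor 2 is that of [card_large_coords_exp]. *)
Lemma expRN3_le (k : nat) : (0 < k)%N -> 2 * expR (k%:R * - 3) <= 2^-1 ^+ k :> R.
Proof.
move=> k0; have e4 : expR (- 3) <= 4^-1 :> R.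
  by rewrite expRN lef_pV2 ?posrE ?expR_gt0 //; have := expR_ge1Dx (3 : R); lra.
rewrite expRM_natl; apply: (@le_trans _ _ (2 * 4^-1 ^+ k)).
  by rewrite ler_wpM2l // lerXn2r ?nnegrE ?expR_ge0.
have -> : 4^-1 = 2^-1 * 2^-1 :> R by lra.
rewrite exprMn mulrA ler_piMl ?exprn_ge0 //.
case: k k0 => // k _; rewrite exprS mulrA divff // mul1r.
by rewrite exprn_ile1 //; lra.
Qed.

Lemma dense_case (t : R) : 1 / 2 <= kappa G -> 1152 <= t ->
  (set_card [set x | (G `&` integer_lattice R d) x /\
                      t * kappa G <= l2norm x / Num.sqrt d%:R])%:R
       <= expR (- (288^-1 * t * Num.sqrt d%:R))
          * (set_card (G `&` integer_lattice R d))%:R.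
Proof.
set K := kappa G => K2 t0.
have K0 : 0 < K by lra.
(* Chosen so that [16 * c ^+ 2 * d] is the square of [t * K] times [d]. *)
pose c := t * K / 4.
have c0 : 0 < c by rewrite /c; nra.
have dR : 0 < d%:R :> R by rewrite ltr0n.
apply: (le_trans (y := _%:R)).
  rewrite ler_nat; apply: (@set_card_l2norm_ge_le (t * K) c d%:R); first nra.
  by rewrite /c; field.
have SK (x : 'rV[R]_d) : x \in lattice_points G -> l1norm x <= K * d%:R.
  exact: l1norm_le_kappa.
apply: (card_large_l2_le d0 (leqnn d) c0).
- by rewrite mulr_ge0 ?expR_ge0.
- by move=> x _; rewrite -[leqRHS]card_ord max_card.
move=> I I0d; have /andP[k0 kd] := I0d; set k := #|I| in k0 kd *.
have kR : 0 < k%:R :> R by rewrite ltr0n.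
pose r : R := Num.sqrt (Num.sqrt (d%:R / k%:R)).
have r1 : 1 <= r := level_ge1 I0d.
pose sd : R := Num.sqrt d%:R.
have sd0 : 0 < sd by rewrite sqrtr_gt0.
have lE : level R d k = sd / k%:R + r by [].
have lk : k%:R * level R d k = sd + k%:R * r by rewrite lE; field; rewrite gt_eqF.
have l1 : 1 <= level R d k by rewrite lE ler_wpDl // divr_ge0 // ltW.
set v := c * level R d k.
have v0 : t * K / 4 <= v by rewrite /v -/c ler_peMr // ltW.
(* An integer with [K <= h <= 3 * K]; the upper bound uses [K >= 1/2]. *)
pose h := (Num.truncn K).+1.
have hR : 1 <= h%:R :> R by rewrite ler1n.
have Kh : K <= h%:R by rewrite ltW // truncnS_gt.
have hK : h%:R <= 3 * K.
  have : (Num.truncn K)%:R <= K by rewrite truncn_le // ltW.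
  by rewrite /h -natr1; lra.
pose a := Num.truncn v.
have v00 : 0 <= v by nra.
have av : a%:R <= v by rewrite truncn_le.
have va : v < a%:R + 1 by rewrite natr1 truncnS_gt.
have h12v : 12 * h%:R <= v by nra.
have a5h : (5 * h <= a)%N by rewrite -(ler_nat R) natrM; lra.
(* As [v >= 12 * h], rounding and the removal of [5 * h] cost at most half of [v]. *)
pose s := (a - 5 * h)%N.
have sE : s%:R = a%:R - 5 * h%:R :> R by rewrite natrB // natrM.
have sv : v / 2 <= s%:R by rewrite sE; lra.
pose m := ((k * s) %/ h)%N.
have mh : (m * h <= k * s)%N by rewrite leq_trunc_div.
have mR : k%:R * s%:R < (m%:R + 1) * h%:R :> R.
  by rewrite natr1 -!natrM ltr_nat ltn_ceil.
have k1 : 1 <= k%:R :> R by rewrite ler1n.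
have ks : 2 * h%:R <= k%:R * s%:R :> R by nra.
have mv : k%:R * v <= 12 * K * m%:R.
  have : k%:R * s%:R <= 2 * m%:R * h%:R :> R by nra.
  have : k%:R * (v / 2) <= k%:R * s%:R by rewrite ler_wpM2l // ltW.
  have : m%:R * h%:R <= m%:R * (3 * K) by rewrite ler_wpM2l.
  lra.
(* Source of the constants: [m / 6] is at least [t * (sd + k * r) / 288], and [t >= 1152 = 4 * 288]
   lets the second part cancel the [4 * k * r] of [bin_le_expR]. *)
have mt : t * (sd + k%:R * r) <= 48 * m%:R.
  rewrite -(ler_pM2r K0) -lk.
  by move: mv; rewrite /v /c; lra.
have := @card_large_coords_exp R d G HG I h s m K d0 isT Kh mh SK.
rewrite /set_card -/(lattice_points G).
set S := #|` lattice_points G|%:R => LS.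
have {}LS : #|` large_coords G I v|%:R <= 2 * expR (- (m%:R / 6)) * S.
  apply: le_trans LS; rewrite ler_nat; apply/fsubset_leq_card/fsubsetP => x.
  move=> /large_coordsP[xS xI]; apply/large_coordsP; split=> // i /xI.
  by apply: le_trans; rewrite /s subnKC.
have S0 : 0 <= S by [].
apply: (@le_trans _ _ (expR (k%:R * (4 * r - 3)) * (2 * expR (- (m%:R / 6)) * S))).
  apply: ler_pM => //.
  have := @bin_le_expR R d d k d0 d0 k0.
  by rewrite divff ?gt_eqF // expr1n mulr1.
rewrite mulrA; rewrite [leRHS]mulrA ler_wpM2r //.
rewrite mulrCA -expRD.
apply: (@le_trans _ _ (2 * (expR (k%:R * - 3) * expR (- (288^-1 * t * sd))))).
  rewrite ler_wpM2l // -expRD ler_expR.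
  have kr : 0 <= k%:R * r by rewrite mulr_ge0 //; lra.
  have : 1152 * (k%:R * r) <= t * (k%:R * r) by rewrite ler_wpM2r.
  lra.
by rewrite mulrA ler_wpM2r ?expR_ge0 // expRN3_le.
Qed.

Lemma sparse_case (t : R) : 0 < kappa G -> kappa G <= 1 / 2 -> 1152 <= t ->
  (set_card [set x | (G `&` integer_lattice R d) x /\
                      t * Num.sqrt (kappa G) <= l2norm x / Num.sqrt d%:R])%:R
       <= kappa G `^ (288^-1 * t * Num.sqrt (d%:R * kappa G))
          * (set_card (G `&` integer_lattice R d))%:R.
Proof.
set K := kappa G => K0 K2 t0.
have [n Kn] : exists n : nat, K * d%:R = n%:R := kappa_lattice HG d0 K0.
have dR : 0 < d%:R :> R by rewrite ltr0n.
have n0 : (0 < n)%N by rewrite -(ltr_nat R) -Kn mulr_gt0.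
have nR : 0 < n%:R :> R by rewrite ltr0n.
have nd2 : (n + n <= d)%N.
  by rewrite -(ler_nat R) natrD -Kn; have := ler_wpM2r (ltW dR) K2; lra.
have nd : (n <= d)%N by lia.
pose c := t / 4.
have c0 : 0 < c by rewrite /c; lra.
rewrite [d%:R * K]mulrC Kn.
pose sn : R := Num.sqrt n%:R.
have sn0 : 0 < sn by rewrite sqrtr_gt0.
pose l := - ln K.
have lK : expR (- l) = K by rewrite opprK lnK ?posrE.
have l2 : 2^-1 <= l.
  rewrite -ler_expR -[expR l]invrK -expRN lK.
  by apply: (le_trans (expR_half_le2 R)); rewrite -[leLHS]invrK lef_pV2 ?posrE //; lra.
have pE e : K `^ e = expR (- (e * l)).
  by rewrite /powR gt_eqF // /l mulrN opprK.
apply: (le_trans (y := _%:R)).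
  rewrite ler_nat; apply: (@set_card_l2norm_ge_le (t * Num.sqrt K) c n%:R).
    by rewrite mulr_ge0 //; lra.
  by rewrite [in RHS]exprMn sqr_sqrtr ?(ltW K0) // -[in RHS]mulrA Kn /c; field.
have Sn (x : 'rV[R]_d) : x \in lattice_points G -> l1norm x <= n%:R.
  by rewrite -Kn; exact: l1norm_le_kappa.
apply: (card_large_l2_le n0 nd c0); first by rewrite mulr_ge0 ?powR_ge0.
  move=> x xS; apply: card_support_le; last exact: Sn.
  by move: xS; rewrite mem_lattice_points // inE => -[].
move=> I I0n; have /andP[k0 kn] := I0n.
set k := #|I| in k0 kn *.
have kR : 1 <= k%:R :> R by rewrite ler1n.
pose r : R := Num.sqrt (Num.sqrt (n%:R / k%:R)).
have r1 : 1 <= r := level_ge1 I0n.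
have lE : level R n k = sn / k%:R + r by [].
have lk : k%:R * level R n k = sn + k%:R * r by rewrite lE; field; rewrite gt_eqF //; lra.
have l1 : 1 <= level R n k.
  by rewrite lE ler_wpDl // divr_ge0 // ltW.
set v := c * level R n k.
have v0 : t / 4 <= v by rewrite /v -/c ler_peMr // ltW.
(* The largest [s] with [s.+1 <= v]; the predecessor is genuine because [v >= t / 4]. *)
pose s := (Num.truncn v).-1.
have sE : s.+1 = Num.truncn v by rewrite prednK // truncn_gt0; lra.
have sv : s.+1%:R <= v by rewrite sE truncn_le //; lra.
have vs : v / 2 <= s%:R.
  have : v < s.+2%:R by rewrite sE truncnS_gt.
  by rewrite -addn2 natrD; lra.
have kst : t / 8 * (sn + k%:R * r) <= k%:R * s%:R.
  rewrite -lk; have : k%:R * (v / 2) <= k%:R * s%:R by rewrite ler_wpM2l.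
  by rewrite /v /c; lra.
have := @card_large_coords_exp_ratio R d G HG I s n nd2 Sn.
rewrite -(ler_nat R) !natrM !natrX /set_card -/(lattice_points G) -/k.
set S := #|` lattice_points G|%:R => LS.
have KE : n%:R / d%:R = K by rewrite -Kn; field; rewrite gt_eqF.
have {}LS : #|` large_coords G I v|%:R <= expR (- (k%:R * s%:R * l)) * S.
  apply: (@le_trans _ _ #|` large_coords G I s.+1%:R|%:R).
    rewrite ler_nat; apply/fsubset_leq_card/fsubsetP => x.
    move=> /large_coordsP[xS xI]; apply/large_coordsP; split=> // i /xI.
    exact: le_trans.
  rewrite -pE -natrM powR_mulrn ?(ltW K0) // -KE expr_div_n.
  by rewrite mulrAC ler_pdivlMr ?exprn_gt0 // [_ ^+ _ * _]mulrC.
have S0 : 0 <= S by [].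
(* The factor [expR (k * l)] is [(d / n) ^+ k], the price of choosing [I] among all [d] coordinates
   although supports have size at most [n]. *)
apply: (@le_trans _ _ ((expR (k%:R * (4 * r - 3)) * expR (k%:R * l)) * (expR (- (k%:R * s%:R * l)) * S))).
  apply: ler_pM => //.
  have := @bin_le_expR R d n k d0 n0 k0.
  have -> : d%:R / n%:R = expR l :> R.
    by rewrite -[expR l]invrK -expRN lK -KE invf_div.
  by rewrite -expRM_natl.
rewrite mulrA [leRHS]mulrA ler_wpM2r // -!expRD pE.
apply: (@le_trans _ _ (2 * expR (k%:R * - 3) * expR (- (288^-1 * t * sn * l)))); last first.
  by rewrite ler_wpM2r ?expR_ge0 // expRN3_le.
rewrite -[leRHS]mulrA -expRD; apply: (@le_trans _ _ (expR (k%:R * - 3 + - (288^-1 * t * sn * l)))); last first.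
  by rewrite ler_peMl ?expR_ge0 //; lra.
rewrite ler_expR; apply: sparse_exponent_le => //; exact: ltW.
Qed.

End Conclusion.

Theorem theorem1p3 (R : realType) :
  exists t0 c : R, 0 < t0 /\ 0 < c /\
  forall (d : nat) (G : set 'rV[R]_d),
    (0 < d)%N -> one_symmetric_bodies R d G ->
    (forall t : R, 1 / 2 <= kappa G -> t0 <= t ->
       (set_card [set x | (G `&` integer_lattice R d) x /\
                      t * kappa G <= l2norm x / Num.sqrt d%:R])%:R
       <= expR (- (c * t * Num.sqrt d%:R))
          * (set_card (G `&` integer_lattice R d))%:R) /\
    (forall t : R, 0 < kappa G -> kappa G <= 1 / 2 -> t0 <= t ->
       (set_card [set x | (G `&` integer_lattice R d) x /\
                      t * Num.sqrt (kappa G) <= l2norm x / Num.sqrt d%:R])%:R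
       <= kappa G `^ (c * t * Num.sqrt (d%:R * kappa G))
          * (set_card (G `&` integer_lattice R d))%:R).

Proof.
exists 1152, 288^-1; split; [|split]; rewrite ?invr_gt0 ?ltr0n //.
move=> d G d0 HG; split=> t.
  by move=> K2 t0; apply: dense_case.
by move=> K0 K2 t0; apply: sparse_case.
Qed.
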